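(* There is a satisfiable HyperLTL sentence that is not satisfied by any $\omega$-regular set of traces.
   Context: Fix a finite set $AP$ of atomic propositions. A trace over $AP$ is a map $t:\mathbb{N}\to 2^{AP}$, i.e., an infinite word over the alphabet $2^{AP}$; a set of traces is $\omega$-regular if it is an $\omega$-regular language over $2^{AP}$. HyperLTL formulas are given by the grammar $\varphi ::= \exists \pi.\ \varphi \mid \forall \pi.\ \varphi \mid \psi$ and $\psi ::= a_\pi \mid \neg\psi \mid \psi\vee\psi \mid \mathbf{X}\psi \mid \psi\,\mathbf{U}\,\psi$, where $a\in AP$ and $\pi$ ranges over a countable set of trace variables. For a set $T$ of traces and a trace assignment $\Pi$ (a partial map from trace variables to traces), with $\Pi[j]$ denoting the assignment mapping each $\pi$ in the domain of $\Pi$ to the suffix $\Pi(\pi)(j)\Pi(\pi)(j+1)\cdots$: $(T,\Pi)\models a_\pi$ iff $a\in\Pi(\pi)(0)$; negation and disjunction are as usual; $(T,\Pi)\models\mathbf{X}\psi$ iff $(T,\Pi[1])\models\psi$; $(T,\Pi)\models\psi_1\mathbf{U}\psi_2$ iff there is $j\ge 0$ with $(T,\Pi[j])\models\psi_2$ and $(T,\Pi[j'])\models\psi_1$ for all $0\le j'<j$; $(T,\Pi)\models\exists\pi.\varphi$ iff there is $t\in T$ with $(T,\Pi[\pi\mapsto t])\models\varphi$; $(T,\Pi)\models\forall\pi.\varphi$ iff this holds for all $t\in T$. A sentence is a formula without free trace variables; $T$ satisfies (is a model of) a sentence $\varphi$ if $(T,\Pi_\emptyset)\models\varphi$ for the empty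 assignment $\Pi_\emptyset$. A sentence is satisfiable if it has a model. *)

(* Defs.v *)
From mathcomp Require Import all_boot.
From mathcomp Require Import classical_sets.

Set Implicit Arguments.
Unset Strict Implicit.
Unset Printing Implicit Defensive.

Definition trace (AP : finType) : Type := nat -> {set AP}.

Definition trace_suffix (AP : finType) (j : nat) (t : trace AP) : trace AP :=
  fun i => t (j + i).

Definition tvar : Type := nat.

Inductive qf_formula (AP : finType) : Type :=
| Atom of AP & tvar
| Neg of qf_formula AP
| Or of qf_formula AP & qf_formula AP
| Next of qf_formula AP
| Until of qf_formula AP & qf_formula AP.

Inductive hyperltl (AP : finType) : Type :=
| HExists of tvar & hyperltl AP
| HForall of tvar & hyperltl AP
| Body of qf_formula AP.

Fixpoint qf_vars (AP : finType) (psi : qf_formula AP) : seq nat :=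
  match psi with
  | Atom _ x => [:: x]
  | Neg p => qf_vars p
  | Or p q => qf_vars p ++ qf_vars q
  | Next p => qf_vars p
  | Until p q => qf_vars p ++ qf_vars q
  end.

Fixpoint free_vars (AP : finType) (phi : hyperltl AP) : seq nat :=
  match phi with
  | HExists x p => [seq y <- free_vars p | y != x]
  | HForall x p => [seq y <- free_vars p | y != x]
  | Body psi => qf_vars psi
  end.

Definition sentence (AP : finType) (phi : hyperltl AP) : Prop :=
  free_vars phi = [::].

Definition assignment (AP : finType) : Type := tvar -> option (trace AP).

Definition empty_assignment (AP : finType) : assignment AP := fun=> None.

Definition update (AP : finType) (Pi : assignment AP) (x : nat) (t : trace AP) :
    assignment AP :=
  fun y => if y == x then Some t else Pi y.

Definition shift_assignment (AP : finType) (j : nat) (Pi : assignment AP) :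
    assignment AP :=
  fun x => omap (trace_suffix j) (Pi x).

(* The set of traces is omitted here: only the quantifiers refer to it.  An
   atom over an unassigned variable is false; this never occurs when
   evaluating a sentence from the empty assignment. *)
Fixpoint qf_sat (AP : finType) (Pi : assignment AP) (psi : qf_formula AP) :
    Prop :=
  match psi with
  | Atom a x => if Pi x is Some t then a \in t 0 else False
  | Neg p => ~ qf_sat Pi p
  | Or p q => qf_sat Pi p \/ qf_sat Pi q
  | Next p => qf_sat (shift_assignment 1 Pi) p
  | Until p q =>
      exists j : nat, qf_sat (shift_assignment j Pi) q /\
        forall j' : nat, j' < j -> qf_sat (shift_assignment j' Pi) p
  end.

Fixpoint sat (AP : finType) (T : set (trace AP)) (Pi : assignment AP)
    (phi : hyperltl AP) : Prop :=
  match phi with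
  | HExists x p => exists t : trace AP, T t /\ sat T (update Pi x t) p
  | HForall x p => forall t : trace AP, T t -> sat T (update Pi x t) p
  | Body psi => qf_sat Pi psi
  end.

Definition models (AP : finType) (T : set (trace AP)) (phi : hyperltl AP) :
    Prop :=
  sat T (empty_assignment AP) phi.

Definition satisfiable (AP : finType) (phi : hyperltl AP) : Prop :=
  exists T : set (trace AP), models T phi.

Record buchi (Sigma : finType) : Type := Buchi {
  state : finType;
  initial : {set state};
  transition : state -> Sigma -> {set state};
  accepting : {set state}
}.

Definition accepting_run (Sigma : finType) (A : buchi Sigma)
    (w : nat -> Sigma) (r : nat -> state A) : Prop :=
  [/\ r 0 \in initial A,
      forall i : nat, r i.+1 \in transition (r i) (w i)
    & forall n : nat, exists i : nat, n <= i /\ r i \in accepting A].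

Definition buchi_language (Sigma : finType) (A : buchi Sigma) :
    set (nat -> Sigma) :=
  fun w => exists r : nat -> state A, accepting_run w r.

(* Omega-regular languages are those recognized by nondeterministic Buchi
   automata with finitely many states. *)
Definition omega_regular (Sigma : finType) (L : set (nat -> Sigma)) : Prop :=
  exists A : buchi Sigma, L = buchi_language A.

(* Main.v *)
Require Import Defs.
From mathcomp Require Import all_boot.
From mathcomp Require Import classical_sets.
From mathcomp Require Import boolp zify.

Set Implicit Arguments.
Unset Strict Implicit.
Unset Printing Implicit Defensive.

(** Over [AP = {a, b}], the sentence says that [T] is nonempty, that every trace
    of [T] is either initial ([a] and [b] at position 0) or one [a]-step and two
    [b]-steps after a trace of [T], and that every trace of [T] has such a
    successor in [T].  By induction on the position of the first [a], a trace of
    [T] with first [a] at [n] has first [b] at [2n], and [n] is unbounded over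
    [T].  An automaton for [T] repeats a state within the first [n] positions
    for large [n]; cutting out the loop, of length [d > 0], yields a trace of [T]
    with first [a] at [n - d] and first [b] at [2n - d], a contradiction. *)

Definition cut (X : Type) (i d : nat) (w : nat -> X) : nat -> X :=
  fun k => if k < i then w k else w (k + d).

(** With [N] the number of states, the first [n + 1] states of an accepting run repeat; deleting the
    loop keeps a run, still accepting because its tail is unchanged. *)
Lemma omega_regular_cut (Sigma : finType) (L : set (nat -> Sigma)) :
  omega_regular L ->
  exists N : nat, forall w n, L w -> N <= n ->
    exists i d : nat, [/\ 0 < d, i + d <= n & L (cut i d w)].
Proof.
case=> A ->; exists #|state A| => w n [r [r0 rS racc]] le_n.
have /injectivePn [x [y neq_xy eq_r]] : ~~ injectiveb (fun k : 'I_n.+1 => r k).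
  apply/negP=> /injectiveP /leq_card; rewrite card_ord; lia.
wlog lt_xy : x y neq_xy eq_r / x < y.
  move=> wl; have [|lt_yx|eq_xy] := ltngtP x y; first exact: wl.
    by apply: (wl y x) => //; rewrite eq_sym.
  by rewrite (ord_inj eq_xy) eqxx in neq_xy.
exists x, (y - x); have /= le_y := ltn_ord y.
split; [lia | lia | exists (cut x (y - x) r); split].
(* If [x] is 0, the shortened run starts at [r y], which equals [r 0]. *)
- rewrite /cut; case: ifP => // x0.
  have -> : 0 + (y - x) = y by lia.
  by rewrite -eq_r; have -> : nat_of_ord x = 0 by lia.
(* As [k < x] means [k.+1 <= x], one comparison settles both tests. Only at [k.+1 = x] is there a
   new transition, into [r y = r x]. *)
- move=> k; rewrite /cut; case: (ltngtP k.+1 x) => [lt_kx | lt_xk | eq_kx].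
  + exact: rS.
  + exact: rS.
  + have -> : k.+1 + (y - x) = y by lia.
    by rewrite -eq_r -eq_kx.
(* A visit this late lies beyond the loop and, moved back by [y - x], still comes after [m]. *)
- move=> m; have [k [le_k acc_k]] := racc (m + x + (y - x)).
  exists (k - (y - x)); split; first lia.
  rewrite /cut ifN; last by lia.
  by have -> : k - (y - x) + (y - x) = k by lia.
Qed.

Definition first_at (AP : finType) (p : AP) (t : trace AP) (n : nat) : Prop :=
  p \in t n /\ forall i, i < n -> p \notin t i.

Lemma first_at_inj (AP : finType) (p : AP) (t : trace AP) m n :
  first_at p t m -> first_at p t n -> m = n.
Proof.
move=> [tm before_m] [tn before_n]; case: (ltngtP m n) => // [/before_n | /before_m].
  by rewrite tm.
by rewrite tn.
Qed.

Lemma first_at_suffix (AP : finType) (p : AP) (c : nat) (t : trace AP) m :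
  (forall i, i < c -> p \notin t i) /\ first_at p (trace_suffix c t) m <->
  first_at p t (c + m).
Proof.
split=> [[before_c [tm before_m]] | [tm before_m]].
- split=> // i lt_i; case: (ltnP i c) => [/before_c // | le_ci].
  by rewrite -(subnKC le_ci); apply: before_m; lia.
- split=> [i lt_i|]; first by apply: before_m; lia.
  by split=> // i lt_i; apply: before_m; lia.
Qed.

Lemma first_at_cut (AP : finType) (p : AP) (t : trace AP) i d n :
  i + d <= n -> first_at p t n -> first_at p (cut i d t) (n - d).
Proof.
move=> le_n [tn before_n]; split=> [|k lt_k]; rewrite /cut.
  by rewrite ifN; [rewrite subnK //; lia | lia].
by case: ifP => _; apply: before_n; lia.
Qed.

Definition qf_and (AP : finType) (p q : qf_formula AP) : qf_formula AP :=
  Neg (Or (Neg p) (Neg q)).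

Lemma qf_sat_and (AP : finType) (Pi : assignment AP) (p q : qf_formula AP) :
  qf_sat Pi (qf_and p q) <-> qf_sat Pi p /\ qf_sat Pi q.
Proof.
split=> /= [npq | [sp sq] []//].
by split; apply: contrapT => ns; apply: npq; [left | right].
Qed.

Definition next_atom (AP : finType) (c : nat) (p : AP) (x : tvar) : qf_formula AP :=
  iter c (@Next AP) (Atom p x).

Lemma qf_sat_next_atom (AP : finType) (Pi : assignment AP) c (p : AP) x t :
  Pi x = Some t -> (qf_sat Pi (next_atom c p x) <-> p \in t c).
Proof.
elim: c Pi t => [|c IHc] Pi t Pix /=; first by rewrite Pix.
by rewrite (IHc _ (trace_suffix 1 t)) // /shift_assignment Pix.
Qed.

(** The until can only end at the first moment either atom holds, and there both must hold; this
    compares first occurrences at unbounded positions. *)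
Definition aligned (AP : finType) (c : nat) (p : AP) (x y : tvar) : qf_formula AP :=
  Until (Neg (Or (Atom p y) (next_atom c p x)))
        (qf_and (Atom p y) (next_atom c p x)).

Lemma qf_sat_aligned (AP : finType) (Pi : assignment AP) c (p : AP) x y s t :
  Pi x = Some s -> Pi y = Some t ->
  (qf_sat Pi (aligned c p x y) <->
   exists m, first_at p t m /\ first_at p (trace_suffix c s) m).
Proof.
move=> Pix Piy.
have atomy j : qf_sat (shift_assignment j Pi) (Atom p y) <-> p \in t j.
  by rewrite /= /shift_assignment Piy /= /trace_suffix addn0.
have atomx j : qf_sat (shift_assignment j Pi) (next_atom c p x) <->
    p \in trace_suffix c s j.
  rewrite (@qf_sat_next_atom _ _ _ _ _ (trace_suffix j s)).
    by rewrite /trace_suffix addnC.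
  by rewrite /shift_assignment Pix.
have atoms j : qf_sat (shift_assignment j Pi) (qf_and (Atom p y) (next_atom c p x)) <->
    p \in t j /\ p \in trace_suffix c s j.
  split=> [/qf_sat_and [/atomy ? /atomx ?] // | [? ?]].
  by apply/qf_sat_and; split; [apply/atomy | apply/atomx].
split=> [[m [/(atoms m) [tm sm] before]] | [m [[tm tbef] [sm sbef]]]].
  exists m; split; split=> // i /before nor; apply/negP => hi; apply: nor.
    by left; apply/atomy.
  by right; apply/atomx.
exists m; split; first exact/(atoms m).
move=> i lt_i [/atomy | /atomx]; first by apply/negP/tbef.
by apply/negP/sbef.
Qed.

Local Notation a := true.
Local Notation b := false.

(** [aligned] ignores the first [c] positions of [x]; the first conjunct excludes [a] and [b] there,
    as [first_at_suffix] demands. *)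
Definition succ_formula (x y : tvar) : qf_formula bool :=
  qf_and (Neg (Or (Atom a x) (Or (Atom b x) (next_atom 1 b x))))
         (qf_and (aligned 1 a x y) (aligned 2 b x y)).

Definition succ_trace (s t : trace bool) : Prop :=
  (exists m, first_at a t m /\ first_at a s m.+1) /\
  (exists m, first_at b t m /\ first_at b s m.+2).

Lemma qf_sat_succ (Pi : assignment bool) x y s t :
  Pi x = Some s -> Pi y = Some t ->
  (qf_sat Pi (succ_formula x y) <-> succ_trace s t).
Proof.
move=> Pix Piy.
have early : qf_sat Pi (Neg (Or (Atom a x) (Or (Atom b x) (next_atom 1 b x)))) <->
    (forall i, i < 1 -> a \notin s i) /\ (forall i, i < 2 -> b \notin s i).
  have /= at1 := qf_sat_next_atom 1 b Pix.
  rewrite /= Pix; split=> [nor | [na nb]].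
    by split=> [[|//] _ | [|[|//]] _]; apply/negP => h; apply: nor; tauto.
  case=> [|[|/at1]]; first exact/negP/na.
    exact/negP/nb.
  exact/negP/nb.
have al c p := qf_sat_aligned c p Pix Piy.
split=> [/qf_sat_and [/early [na nb] /qf_sat_and [/al [m [tm sm]] /al [k [tk sk]]]]
       | [[m [tm sm]] [k [tk sk]]]].
  split; [exists m | exists k]; split=> //.
    by apply/(first_at_suffix _ 1).
  by apply/(first_at_suffix _ 2).
have [na sm'] := (first_at_suffix a 1 s m).2 sm.
have [nb sk'] := (first_at_suffix b 2 s k).2 sk.
apply/qf_sat_and; split; first exact/early.
by apply/qf_sat_and; split; apply/al; [exists m | exists k].
Qed.

(** Variable 1 is the current trace, 2 its predecessor, 3 its successor. *)
Definition doubling_body : qf_formula bool :=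
  qf_and (Or (qf_and (Atom a 1) (Atom b 1)) (succ_formula 1 2)) (succ_formula 3 1).

Lemma qf_sat_doubling_body (Pi : assignment bool) t s u :
  Pi 1 = Some t -> Pi 2 = Some s -> Pi 3 = Some u ->
  (qf_sat Pi doubling_body <->
   (a \in t 0 /\ b \in t 0 \/ succ_trace t s) /\ succ_trace u t).
Proof.
move=> Pi1 Pi2 Pi3.
have ab := qf_sat_and Pi (Atom a 1) (Atom b 1); rewrite [X in _ <-> X]/= Pi1 in ab.
have ts := qf_sat_succ Pi1 Pi2.
have ut := qf_sat_succ Pi3 Pi1.
have orE p q : qf_sat Pi (Or p q) <-> qf_sat Pi p \/ qf_sat Pi q by [].
have := orE (qf_and (Atom a 1) (Atom b 1)) (succ_formula 1 2).
have := qf_sat_and Pi (Or (qf_and (Atom a 1) (Atom b 1)) (succ_formula 1 2))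
  (succ_formula 3 1).
by rewrite /doubling_body; tauto.
Qed.

(* The outer existential only forces the set of traces to be nonempty. *)
Definition doubling : hyperltl bool :=
  HExists 0 (HForall 1 (HExists 2 (HExists 3 (Body doubling_body)))).

Lemma models_doubling (T : set (trace bool)) :
  models T doubling <->
  (exists t, T t) /\
  forall t, T t ->
    (a \in t 0 /\ b \in t 0 \/ exists s, T s /\ succ_trace t s) /\
    exists s, T s /\ succ_trace s t.
Proof.
have body t0 t s u := @qf_sat_doubling_body
  (update (update (update (update (@empty_assignment bool) 0 t0) 1 t) 2 s) 3 u)
  t s u erefl erefl erefl.
split=> [[t0 [Tt0 all_t]] | [[t0 Tt0] all_t]].
  split=> [|t Tt]; first by exists t0.
  have [s [Ts [u [Tu /(body t0 t s u) [bs us]]]]] := all_t t Tt.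
  split; last by exists u.
  by case: bs => [|ts]; [left | right; exists s].
exists t0; split=> // t Tt.
have [bs [u [Tu us]]] := all_t t Tt.
have [s [Ts bs']] : exists s, T s /\ (a \in t 0 /\ b \in t 0 \/ succ_trace t s).
  (* Prenex form requires a value for the predecessor even when [t] is initial; [t] itself
     serves. *)
  case: bs => [b0 | [s [Ts ts]]]; first by exists t; split=> //; left.
  by exists s; split=> //; right.
by exists s; split=> //; exists u; split=> //; apply/(body t0 t s u).
Qed.

Definition doubling_trace (n : nat) : trace bool :=
  fun i => [set p | i == (if p then n else n.*2)].

Lemma first_at_doubling_trace p n :
  first_at p (doubling_trace n) (if p then n else n.*2).
Proof. by split=> [|i lt_i]; rewrite inE // neq_ltn lt_i. Qed.

Lemma succ_doubling_trace n : succ_trace (doubling_trace n.+1) (doubling_trace n).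
Proof.
by split; [exists n | exists n.*2]; split;
  apply: first_at_doubling_trace.
Qed.

Lemma doubling_satisfiable : satisfiable doubling.
Proof.
exists (fun t => exists n, t = doubling_trace n); apply/models_doubling.
split=> [|_ [n ->]]; first by exists (doubling_trace 0), 0.
split; last by exists (doubling_trace n.+1); split; [exists n.+1 | apply: succ_doubling_trace].
case: n => [|n]; first by left; rewrite !inE.
by right; exists (doubling_trace n); split; [exists n | apply: succ_doubling_trace].
Qed.

(** Induction on [n] through predecessors: the initial alternative is possible only for [n = 0], the
    predecessor alternative only for positive [n]. *)
Lemma doubling_first_at (T : set (trace bool)) t n :
  models T doubling -> T t -> first_at a t n -> first_at b t n.*2.
Proof.
move=> /models_doubling [_ all_t].
elim: n t => [|n IHn] t Tt tn;
  have [[[a0 b0] | [s [Ts [[m [sm tm]] [k [sk tk]]]]]] _] := all_t t Tt.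
- by split.
- by have := first_at_inj tn tm.
- by case: tn => _ /(_ 0 isT); rewrite a0.
- have [eq_nm] := first_at_inj tn tm.
  rewrite -eq_nm in sm.
  by rewrite doubleS (first_at_inj (IHn s Ts sm) sk).
Qed.

Lemma doubling_unbounded (T : set (trace bool)) N :
  models T doubling -> exists t n, [/\ T t, N <= n & first_at a t n].
Proof.
move=> /models_doubling [[t0 Tt0] all_t].
elim: N => [|N [t [n [Tt le_N tn]]]].
  (* The successor clause for [t0] already forces an [a] to occur in [t0]. *)
  by have [_ [_ [_ [[m [tm _]] _]]]] := all_t _ Tt0; exists t0, m.
have [_ [s [Ts [[m [tm sm]] _]]]] := all_t _ Tt.
by exists s, m.+1; split; rewrite // ltnS -(first_at_inj tn tm).
Qed.

Theorem theorem3 :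
  exists (AP : finType) (phi : hyperltl AP),
    [/\ sentence phi,
        satisfiable phi
      & forall T : set (trace AP), @omega_regular {set AP} T -> ~ models T phi].
Proof.
exists bool, doubling; split=> [//||T /omega_regular_cut [N cutT] modT].
  exact: doubling_satisfiable.
have [t [n [Tt le_N ta]]] := doubling_unbounded N modT.
have [i [d [d_gt0 le_n Tcut]]] := cutT t n Tt le_N.
have tb := doubling_first_at modT Tt ta.
(* The deleted block ends by [n], hence also before the first [b] at [n.*2], so both first
   occurrences move by the same [d]. *)
have cut_b : first_at b (cut i d t) (n.*2 - d) by apply: first_at_cut tb; lia.
have := doubling_first_at modT Tcut (first_at_cut le_n ta).
(* [n.*2 - d] and [(n - d).*2] differ because [0 < d <= n]. *)
by move=> /(first_at_inj cut_b); lia.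
Qed.
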